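(* Let $(Y,\mathcal{A},\nu,S)$ be an ergodic dynamical system and let $g\in L^\infty(Y,\nu)$. Then $g$ is uniform if and only if for every sequence $(G_k)_{k=1}^\infty$ of sets $G_k\in\mathcal{A}$ with $\nu(G_k)>0$, $$\frac1k\sum_{i=0}^{k-1}\frac{1}{\nu(G_k)}\int_{G_k}S^i g\,\mathrm{d}\nu\;\longrightarrow\;\int g\,\mathrm{d}\nu\qquad(k\to\infty).$$
   Context: A dynamical system $(Y,\mathcal{A},\nu,S)$ is a probability space $(Y,\mathcal{A},\nu)$ with a measurable $\nu$-preserving map $S:Y\to Y$; ergodic means $S$ is ergodic with respect to $\nu$. $S$ also denotes the operator on functions $Sg=g\circ S$, so $S^i g=g\circ S^i$. Functions in $L^\infty$ are complex-valued. A function $g\in L^\infty(Y,\nu)$ is called uniform if $\frac1k\sum_{i=0}^{k-1}S^i g\to\int g\,\mathrm{d}\nu$ in $L^\infty(Y,\nu)$-norm as $k\to\infty$. *)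

(* Defs.v *)
From HB Require Import structures.
From mathcomp Require Export all_boot all_order all_algebra.
From mathcomp Require Export all_classical all_reals all_analysis.
From mathcomp Require Export complex.
Export numFieldNormedType.Exports.

Set Implicit Arguments.
Unset Strict Implicit.
Unset Printing Implicit Defensive.

Import Order.TTheory GRing.Theory Num.Theory.

Local Open Scope classical_set_scope.
Local Open Scope ring_scope.

(* Functions in L^oo are represented by honest functions Y -> R[i]; all notions
   below are invariant under nu-almost everywhere equality. *)

Section complex_functions.
Context {d : measure_display} {Y : measurableType d} {R : realType}.
Variable nu : {measure set Y -> \bar R}.
Implicit Types (f g : Y -> R[i]) (D : set Y).

Definition Cmeasurable f : Prop :=
  measurable_fun [set: Y] (fun y => complex.Re (f y)) /\
  measurable_fun [set: Y] (fun y => complex.Im (f y)).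

Definition Cintegral D f : R[i] :=
  Complex (Rintegral nu D (fun y => complex.Re (f y)))
          (Rintegral nu D (fun y => complex.Im (f y))).

(* ComplexField.normc is the R-valued modulus (the norm `|z| on R[i] is itself
   R[i]-valued). *)
Definition Linfty_norm f : \bar R :=
  Lnorm nu +oo (fun y => (ComplexField.Normc.normc (f y))%:E).

Definition Linfty f : Prop := Cmeasurable f /\ (Linfty_norm f < +oo)%E.

End complex_functions.

Section dynamical_systems.
Context {d : measure_display} {Y : measurableType d} {R : realType}.
Variable nu : probability Y R.
Variable S : Y -> Y.

Definition measure_preserving : Prop :=
  measurable_fun [set: Y] S /\
  forall A : set Y, measurable A -> nu (S @^-1` A) = nu A.

Definition ergodic : Prop :=
  forall A : set Y, measurable A -> S @^-1` A = A ->
    nu A = 0%E \/ nu A = 1%E.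

Definition ergodic_dynamical_system : Prop := measure_preserving /\ ergodic.

Definition koopman (g : Y -> R[i]) : Y -> R[i] := g \o S.

Definition uniform (g : Y -> R[i]) : Prop :=
  Linfty_norm nu (fun y => (k%:R)^-1 * (\sum_(i < k) iter i koopman g y)
                           - Cintegral nu [set: Y] g) @[k --> \oo] --> 0%E.

End dynamical_systems.

(* Main.v *)
Require Import Defs.
From mathcomp Require Import all_boot all_order all_algebra.
From mathcomp Require Import all_classical all_reals all_analysis.
From mathcomp Require Import measurable_realfun ess_sup_inf complex lra.
Set Implicit Arguments.
Unset Strict Implicit.
Unset Printing Implicit Defensive.

Import Order.TTheory GRing.Theory Num.Theory.
Import numFieldNormedType.Exports.

(** Let [h_k] be the difference between the [k]-th ergodic average of [g] and the
    integral of [g].  The expression attached to [(G_k)], minus the integral of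
    [g], is the average of [h_k] over [G_k], so it is controlled by the
    [Linfty_norm] of [h_k].  Conversely, every [f] in [Linfty] admits a set of
    positive measure over which its average is at least a fixed fraction of its
    norm: on a set where, say, the real part exceeds a multiple of the norm, no
    cancellation occurs.  Choosing such a set [G_k] for each [h_k] turns the
    convergence of the averages into uniformity. *)

Local Open Scope classical_set_scope.
Local Open Scope ring_scope.

Local Notation normc := ComplexField.Normc.normc.

(** * Modulus estimates and convergence criteria with real tolerances *)

Section modulus_and_convergence.
Context {R : realType}.
Implicit Types z w : R[i].

Lemma normcE_Re_Im z : normc z = Num.sqrt (complex.Re z ^+ 2 + complex.Im z ^+ 2).
Proof. by case: z. Qed.

Lemma normc_ge0 z : 0 <= normc z.
Proof. by rewrite normcE_Re_Im sqrtr_ge0. Qed.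

Lemma normr_Re_le z : `|complex.Re z| <= normc z.
Proof. by rewrite normcE_Re_Im -sqrtr_sqr ler_wsqrtr// lerDl sqr_ge0. Qed.

Lemma normr_Im_le z : `|complex.Im z| <= normc z.
Proof. by rewrite normcE_Re_Im -sqrtr_sqr ler_wsqrtr// lerDr sqr_ge0. Qed.

(** Squaring the right side gives the square of the left plus the nonnegative cross term. *)
Lemma normc_le_Re_Im z : normc z <= `|complex.Re z| + `|complex.Im z|.
Proof.
rewrite normcE_Re_Im -[leRHS]ger0_norm ?addr_ge0// -sqrtr_sqr ler_wsqrtr//.
rewrite sqrrD !real_normK ?num_real// lerD2r lerDl.
by rewrite mulrn_wge0// mulr_ge0.
Qed.

Lemma normc_real (r : R) : normc r%:C%C = `|r|.
Proof. by rewrite /= expr0n addr0 sqrtr_sqr. Qed.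

(** The norm on [R[i]] is [R[i]]-valued, so the library criterion quantifies over complex
    tolerances. A positive element of [R[i]] has zero imaginary part, hence real tolerances
    suffice. *)
Lemma cvgc_distP (u : nat -> R[i]) (l : R[i]) :
  ((u k : R[i]^o) @[k --> \oo] --> (l : R[i]^o)) <->
  forall e : R, 0 < e -> \forall k \near \oo, normc (u k - l) <= e.
Proof.
rewrite (cvgrPdist_le (V := R[i]^o)); split=> [ul e e0|ul e].
  have := ul e%:C%C; rewrite ltcR => /(_ e0).
  apply: filterS => k; rewrite distrC.
  by rewrite -lecR.
rewrite ltcE/= => /andP[/eqP e0 /ul].
apply: filterS => k; rewrite distrC => h.
have -> : e = (complex.Re e)%:C%C by case: e e0 {ul h} => a b /= ->.
by rewrite [`|_|]/(Num.norm _)/= lecR.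
Qed.

(** Terms may be infinite, but only finitely many of them: for the converse, the tolerance 1 already
    forces eventual finiteness. The rest is convergence of real numbers. *)
Lemma cvge0_leP (u : nat -> \bar R) : (forall k, 0 <= u k)%E ->
  u k @[k --> \oo] --> 0%E <->
  forall e : R, 0 < e -> \forall k \near \oo, (u k <= e%:E)%E.
Proof.
move=> u0; split=> [/fine_cvgP[ufin /cvgrPdist_le u_0] e /u_0|ule].
  apply: filterS2 ufin => k ufin /=; rewrite sub0r normrN => h.
  by rewrite -(fineK ufin) lee_fin (le_trans (ler_norm _)).
apply/fine_cvgP; split.
  apply: filterS (ule 1 ltr01) => k uk.
  by rewrite ge0_fin_numE// (le_lt_trans uk)// ltry.
apply/cvgrPdist_le => e /ule; apply: filterS => k uk /=.
have ufin : u k \is a fin_num by rewrite ge0_fin_numE// (le_lt_trans uk)// ltry.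
by rewrite sub0r normrN ger0_norm ?fine_ge0// -lee_fin fineK.
Qed.

End modulus_and_convergence.

(** * Averages of real functions and almost everywhere bounds *)

Section real_averages.
Context d (T : measurableType d) (R : realType).
Variable mu : probability T R.
Implicit Types (u : T -> R) (G : set T).

Lemma ae_bounded_integral_le u (M : R) G : measurable G ->
  measurable_fun [set: T] u -> (\forall x \ae mu, `|u x| <= M) -> 0 <= M ->
  (\int[mu]_(x in G) `|(u x)%:E| <= M%:E * mu G)%E.
Proof.
move=> mG mu_ uM M0; rewrite -integral_cst//.
apply: ae_ge0_le_integral => //.
- by apply/measurable_EFinP/measurableT_comp => //; exact: measurable_funTS.
- by apply: filterS uM => x ux _ /=; rewrite lee_fin.
Qed.

Lemma ae_bounded_integrable u (M : R) G : measurable G ->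
  measurable_fun [set: T] u -> (\forall x \ae mu, `|u x| <= M) ->
  mu.-integrable G (EFin \o u).
Proof.
move=> mG mu_ uM; apply/integrableP; split.
  by apply/measurable_EFinP; exact: measurable_funTS.
(* The sign of [M] is not given, while the integral estimate asks for a nonnegative bound. *)
have uM' : \forall x \ae mu, `|u x| <= `|M|.
  by apply: filterS uM => x /le_trans; apply; exact: ler_norm.
have h := ae_bounded_integral_le mG mu_ uM' (normr_ge0 M).
apply: (le_lt_trans h).
by rewrite lte_mul_pinfty// ltey_eq fin_num_measure.
Qed.

Lemma normr_Rintegral_le u (M : R) G : measurable G ->
  measurable_fun [set: T] u -> (\forall x \ae mu, `|u x| <= M) -> 0 <= M ->
  `|Rintegral mu G u| <= M * fine (mu G).
Proof.
move=> mG mu_ uM M0.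
have iu := ae_bounded_integrable mG mu_ uM.
apply: le_trans (le_normr_Rintegral mG iu) _.
have := ae_bounded_integral_le mG mu_ uM M0.
rewrite -[in leRHS](fineK (fin_num_measure mu G mG)) -EFinM -lee_fin.
rewrite /Rintegral fineK// ge0_fin_numE ?integral_ge0//.
by case/integrableP : iu.
Qed.

(** If the set where [u] exceeds [t] had positive measure, the average of [u] over it would be at
    least [t], hence larger than [s]. Since integration yields only this weak inequality, the gap
    between [s] and [t] supplies the contradiction. *)
Lemma averages_le_ae_le u (s t : R) : measurable_fun [set: T] u ->
  (forall G, measurable G -> mu.-integrable G (EFin \o u)) -> s < t ->
  (forall G, measurable G -> (0 < mu G)%E ->
     Rintegral mu G u <= s * fine (mu G)) ->
  \forall x \ae mu, u x <= t.
Proof.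
move=> mu_ iu st us.
suff : \forall x \ae mu, ((u x)%:E <= t%:E)%E.
  by apply: filterS => x; rewrite lee_fin.
have mEu : measurable_fun [set: T] (EFin \o u) by exact/measurable_EFinP.
apply: (ae_le_measureP mu t%:E mEu).2.
set A := (EFin \o u) @^-1` _.
have mA : measurable A.
  by rewrite -[A]setTI; apply: mEu => //; exact: emeasurable_itv.
apply/eqP/negP => /negP A0; have {}A0 : (0 < mu A)%E.
  by rewrite lt0e A0 measure_ge0.
have Afin := fin_num_measure mu A mA.
have := us A mA A0; apply/negP; rewrite -ltNge.
apply: (@lt_le_trans _ _ (t * fine (mu A))).
  by rewrite ltr_pM2r// fine_gt0// A0 ltey_eq Afin.
rewrite -Rintegral_cst//; apply: le_Rintegral => //.
- by apply/finite_measure_integrable_cst.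
- exact: iu.
- by move=> x; rewrite /A /= in_itv/= andbT lte_fin => /ltW.
Qed.

(** The one-sided bound is applied to [u] and to [- u]. *)
Lemma normr_averages_le_ae_le u (s t : R) : measurable_fun [set: T] u ->
  (forall G, measurable G -> mu.-integrable G (EFin \o u)) -> s < t ->
  (forall G, measurable G -> (0 < mu G)%E ->
     `|Rintegral mu G u| <= s * fine (mu G)) ->
  \forall x \ae mu, `|u x| <= t.
Proof.
move=> mu_ iu st us.
have ut : \forall x \ae mu, u x <= t.
  apply: (averages_le_ae_le mu_ iu st) => G mG G0.
  exact: le_trans (ler_norm _) (us _ mG G0).
have uNt : \forall x \ae mu, - u x <= t.
  apply: (averages_le_ae_le _ _ st) => [|G mG|G mG G0].
  - exact: measurableT_comp.
  - rewrite (_ : EFin \o _ = \- (EFin \o u))%E//; exact/integrableN/iu.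
  rewrite (_ : Rintegral _ _ _ = - Rintegral mu G u).
    by rewrite (le_trans (ler_norm _))// normrN us.
  rewrite -mulN1r -RintegralZl//; last exact: iu.
  by apply: eq_Rintegral => x _; rewrite mulN1r.
by apply: filterS2 ut uNt => x ut uNt; rewrite ler_norml lerNl ut uNt.
Qed.

End real_averages.

(** * Essentially bounded complex functions, their integrals and averages *)

Section Linfty_theory.
Context {d : measure_display} {Y : measurableType d} {R : realType}.
Variable nu : probability Y R.
Implicit Types (f g : Y -> R[i]) (c : R[i]) (G : set Y).

Lemma Linfty_norm_leP f (M : R) :
  (Linfty_norm nu f <= M%:E)%E <-> \forall x \ae nu, normc (f x) <= M.
Proof.
(* [Lnorm] at exponent [+oo] is the essential supremum only if the whole space has positive measure;
   here that measure is 1. *)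
rewrite /Linfty_norm unlock /Lnorm; set b := (X in if X then _ else _).
have -> : b by rewrite /b [X in (_ < X)%E]probability_setT lte01.
split=> [/ess_supP|fM]; last apply/ess_supP.
  by apply: filterS => x /=; rewrite lee_fin ger0_norm// normc_ge0.
by apply: filterS fM => x /=; rewrite lee_fin ger0_norm// normc_ge0.
Qed.

Lemma LinftyP f :
  Linfty nu f <-> Cmeasurable f /\ exists M : R, \forall x \ae nu, normc (f x) <= M.
Proof.
split=> [[mf foo]|[mf [M fM]]]; split=> //.
  have ffin : Linfty_norm nu f \is a fin_num by rewrite ge0_fin_numE// Lnorm_ge0.
  by exists (fine (Linfty_norm nu f)); apply/Linfty_norm_leP; rewrite fineK.
by rewrite (@le_lt_trans _ _ M%:E) ?ltry//; exact/Linfty_norm_leP.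
Qed.

Lemma Linfty_cst c : Linfty nu (fun=> c).
Proof.
apply/LinftyP; split; first by split; exact: measurable_cst.
by exists (normc c); exact: nearW.
Qed.

Lemma LinftyD f g : Linfty nu f -> Linfty nu g -> Linfty nu (fun x => f x + g x).
Proof.
move=> /LinftyP[[mRf mIf] [M fM]] /LinftyP[[mRg mIg] [N gN]].
apply/LinftyP; split.
  split; [under eq_fun do rewrite raddfD|under eq_fun do rewrite raddfD];
  exact: measurable_funD.
exists (M + N); apply: filterS2 fM gN => x fM gN.
by rewrite (le_trans (le_normcD _ _))// lerD.
Qed.

Lemma LinftyZ c f : Linfty nu f -> Linfty nu (fun x => c * f x).
Proof.
move=> /LinftyP[[mRf mIf] [M fM]]; apply/LinftyP; split.
  split.
    rewrite (_ : (fun _ => _) =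
      (fun x => complex.Re c * complex.Re (f x) - complex.Im c * complex.Im (f x))).
      by apply: measurable_funB; exact: measurable_funM.
    by apply/funext => x; case: c (f x) => ? ? [].
  rewrite (_ : (fun _ => _) =
    (fun x => complex.Re c * complex.Im (f x) + complex.Im c * complex.Re (f x))).
    by apply: measurable_funD; exact: measurable_funM.
  by apply/funext => x; case: c (f x) => ? ? [].
exists (normc c * M); apply: filterS fM => x fM.
by rewrite ComplexField.Normc.normcM ler_wpM2l// normc_ge0.
Qed.

Lemma Linfty_sum (I : Type) (r : seq I) (f : I -> Y -> R[i]) :
  (forall i, Linfty nu (f i)) -> Linfty nu (fun x => \sum_(i <- r) f i x).
Proof.
move=> foo; elim: r => [|i r ih].
  by under eq_fun do rewrite big_nil; exact: Linfty_cst.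
by under eq_fun do rewrite big_cons; exact: LinftyD.
Qed.

Lemma Linfty_integrable f G : Linfty nu f -> measurable G ->
  nu.-integrable G (EFin \o (fun x => complex.Re (f x))) /\
  nu.-integrable G (EFin \o (fun x => complex.Im (f x))).
Proof.
move=> /LinftyP[[mRf mIf] [M fM]] mG; split; apply: (ae_bounded_integrable mG) => //.
  by apply: filterS fM => x; apply: le_trans; exact: normr_Re_le.
by apply: filterS fM => x; apply: le_trans; exact: normr_Im_le.
Qed.

Lemma Cintegral_cst c G : measurable G ->
  Cintegral nu G (fun=> c) = (fine (nu G))%:C%C * c.
Proof.
move=> mG; rewrite /Cintegral !Rintegral_cst//; case: c => a b /=.
by apply/eqP; rewrite eq_complex /= !mul0r subr0 addr0 !(mulrC (fine _)) !eqxx.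
Qed.

Lemma CintegralD f g G : Linfty nu f -> Linfty nu g -> measurable G ->
  Cintegral nu G (fun x => f x + g x) = Cintegral nu G f + Cintegral nu G g.
Proof.
move=> foo goo mG.
have [iRf iIf] := Linfty_integrable foo mG.
have [iRg iIg] := Linfty_integrable goo mG.
rewrite /Cintegral; apply/eqP; rewrite eq_complex /= -!RintegralD//.
by apply/andP; split; apply/eqP/eq_Rintegral => x _; rewrite raddfD.
Qed.

Lemma CintegralZ c f G : Linfty nu f -> measurable G ->
  Cintegral nu G (fun x => c * f x) = c * Cintegral nu G f.
Proof.
move=> foo mG; have [iRf iIf] := Linfty_integrable foo mG.
have iZ (r : R) (u : Y -> R) : nu.-integrable G (EFin \o u) ->
  nu.-integrable G (EFin \o (fun x => r * u x)).
  by move=> iu; rewrite (_ : _ \o _ = (fun x => r%:E * (EFin \o u) x))%E//;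
    exact: integrableZl.
case: c => a b; rewrite /Cintegral; apply/eqP; rewrite eq_complex /=.
rewrite -!RintegralZl//.
rewrite -RintegralB//; [|exact: iZ..]; rewrite -RintegralD//; [|exact: iZ..].
by apply/andP; split; apply/eqP/eq_Rintegral => x _; case: (f x).
Qed.

Lemma Cintegral_sum (I : Type) (r : seq I) (f : I -> Y -> R[i]) G :
  (forall i, Linfty nu (f i)) -> measurable G ->
  Cintegral nu G (fun x => \sum_(i <- r) f i x) = \sum_(i <- r) Cintegral nu G (f i).
Proof.
move=> foo mG; elim: r => [|i r ih].
  by under eq_fun do rewrite big_nil; rewrite big_nil Cintegral_cst// mulr0.
under eq_fun do rewrite big_cons; rewrite big_cons -ih CintegralD//.
exact: Linfty_sum.
Qed.

Definition Caverage G f : R[i] := ((fine (nu G))%:C%C)^-1 * Cintegral nu G f.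

(** With the denominator cleared, a bound on an average becomes a bound of the form
    [M * fine (nu G)] on an integral, the shape used in the real estimates. *)
Lemma normc_Caverage G f : measurable G -> (0 < nu G)%E ->
  normc (Caverage G f) * fine (nu G) = normc (Cintegral nu G f).
Proof.
move=> mG G0.
have G0' : 0 < fine (nu G) by rewrite fine_gt0// G0 ltey_eq fin_num_measure.
rewrite /Caverage ComplexField.Normc.normcM ComplexField.Normc.normcV normc_real.
by rewrite gtr0_norm// mulrAC mulVf ?mul1r// gt_eqF.
Qed.

(** Real and imaginary parts are each bounded by [M] almost everywhere and are integrated
    separately, whence the factor 2. Any fixed constant serves for convergence to zero. *)
Lemma normc_Caverage_le G f (M : R) : Linfty nu f -> measurable G ->
  (0 < nu G)%E -> (Linfty_norm nu f <= M%:E)%E -> normc (Caverage G f) <= 2 * M.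
Proof.
move=> /LinftyP[[mRf mIf] _] mG G0 /[dup] NM /Linfty_norm_leP fM.
have M0 : 0 <= M by rewrite -lee_fin (le_trans _ NM)// Lnorm_ge0.
have G0' : 0 < fine (nu G) by rewrite fine_gt0// G0 ltey_eq fin_num_measure.
rewrite -(ler_pM2r G0') normc_Caverage// (le_trans (normc_le_Re_Im _))//.
rewrite -mulrA mulr_natl mulr2n lerD//=; apply: normr_Rintegral_le => //.
  by apply: filterS fM => x; apply: le_trans; exact: normr_Re_le.
by apply: filterS fM => x; apply: le_trans; exact: normr_Im_le.
Qed.

(* Passing to real and imaginary parts costs a factor 2; the rest of the 8 leaves
   room for strict inequalities. *)
Lemma exists_Caverage_ge f : Linfty nu f ->
  exists G, [/\ measurable G, (0 < nu G)%E &
    (Linfty_norm nu f <= (8 * normc (Caverage G f))%:E)%E].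
Proof.
move=> /[dup] foo [[mRf mIf] Noo]; apply: contrapT => noG.
set N := Linfty_norm nu f in Noo noG.
have N0 : (0 <= N)%E by exact: Lnorm_ge0.
have Nfin : N \is a fin_num by rewrite ge0_fin_numE.
(* By [noG], every average has modulus at most an eighth of the norm. *)
have small G : measurable G -> (0 < nu G)%E ->
    normc (Cintegral nu G f) <= fine N / 8 * fine (nu G).
  move=> mG G0; rewrite -normc_Caverage//.
  rewrite ler_wpM2r ?fine_ge0// ler_pdivlMr// mulrC leNgt; apply/negP => lt.
  by apply: noG; exists G; split=> //; rewrite -(fineK Nfin) lee_fin ltW.
have N_gt0 : 0 < fine N.
  (* If the norm vanished, the whole space would be a witness, against [noG]. *)
  rewrite lt0r fine_ge0// andbT; apply/eqP => NE; apply: noG; exists setT.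
  rewrite probability_setT; split=> //.
  by rewrite -(fineK Nfin) NE lee_fin mulr_ge0// normc_ge0.
have lt84 : fine N / 8 < fine N / 4 by lra.
have Re_le : \forall x \ae nu, `|complex.Re (f x)| <= fine N / 4.
  apply: (normr_averages_le_ae_le mRf _ lt84) => G mG.
    by have [] := Linfty_integrable foo mG.
  by move=> G0; apply: le_trans (small _ mG G0); exact: (normr_Re_le (Cintegral _ _ _)).
have Im_le : \forall x \ae nu, `|complex.Im (f x)| <= fine N / 4.
  apply: (normr_averages_le_ae_le mIf _ lt84) => G mG.
    by have [] := Linfty_integrable foo mG.
  by move=> G0; apply: le_trans (small _ mG G0); exact: (normr_Im_le (Cintegral _ _ _)).
(* The two quarter bounds add up to half of the norm, which is impossible for a positive norm. *)
have : (N <= (fine N / 2)%:E)%E.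
  apply/Linfty_norm_leP; apply: filterS2 Re_le Im_le => x Re_le Im_le.
  by rewrite (le_trans (normc_le_Re_Im _))//; lra.
by rewrite -[leLHS](fineK Nfin) lee_fin; apply/negP; rewrite -ltNge; lra.
Qed.

(** Composition with [S] keeps the almost everywhere bound, because the preimage under [S] of the
    exceptional null set is again null. *)
Lemma Linfty_koopman_iter (S : Y -> Y) i f : measure_preserving nu S ->
  Linfty nu f -> Linfty nu (iter i (koopman S) f).
Proof.
move=> [mS nuS] foo; elim: i => //= i /LinftyP[[mRf mIf] [M fM]].
apply/LinftyP; split.
  by split; [exact: (measurableT_comp mRf mS)|exact: (measurableT_comp mIf mS)].
exists M; case: fM => A [mA A0 fMA]; exists (S @^-1` A); split.
- by rewrite -[X in measurable X]setTI; exact: mS.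
- by rewrite nuS.
- by move=> x /= ?; exact: fMA.
Qed.

End Linfty_theory.

(** * Uniformity through averages over sets of positive measure *)

Theorem theorem1p1 (R : realType) (d : measure_display) (Y : measurableType d)
    (nu : probability Y R) (S : Y -> Y) (g : Y -> R[i]%C) :
  ergodic_dynamical_system nu S ->
  Linfty nu g ->
  uniform nu S g <->
  (forall G : nat -> set Y,
     (forall k, (0 < k)%N -> measurable (G k) /\ (0 < nu (G k))%E) ->
     ((k%:R)^-1 * \sum_(i < k)
        ((fine (nu (G k)))%:C%C)^-1
          * Cintegral nu (G k) (iter i (koopman S) g) : R[i]^o) @[k --> \oo]
     --> (Cintegral nu [set: Y] g : R[i]^o)).
Proof.
move=> [presS _] goo.
set c := Cintegral nu setT g.
pose h k y := (k%:R)^-1 * (\sum_(i < k) iter i (koopman S) g y) - c.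
have goo_i i : Linfty nu (iter i (koopman S) g) by exact: Linfty_koopman_iter.
have hoo k : Linfty nu (h k).
  apply: LinftyD; last exact: Linfty_cst.
  by apply: LinftyZ; exact: Linfty_sum.
(* Linearity of the integral; positivity of [nu G] ensures that the average of the constant [c] is
   [c] itself. *)
have averageE k G : measurable G -> (0 < nu G)%E ->
    (k%:R)^-1 * (\sum_(i < k) ((fine (nu G))%:C%C)^-1
      * Cintegral nu G (iter i (koopman S) g)) - c = Caverage nu G (h k).
  move=> mG G0; have G0' : (fine (nu G))%:C%C != 0.
    have : 0 < (fine (nu G))%:C%C.
      by rewrite ltcR fine_gt0// G0 ltey_eq fin_num_measure.
    by move/lt0r_neq0.
  rewrite /Caverage CintegralD//; last 2 first.
  - by apply: LinftyZ; exact: Linfty_sum.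
  - exact: Linfty_cst.
  rewrite CintegralZ//; last exact: Linfty_sum.
  rewrite Cintegral_sum// Cintegral_cst// mulrDr mulKf//.
  by rewrite -mulr_sumr mulrCA.
rewrite /uniform (cvge0_leP (fun k => Lnorm_ge0 _ _ _)); split.
- move=> unif G GP; apply/cvgc_distP => e e0.
  have e20 : 0 < e / 2 by rewrite divr_gt0.
  (* The sets [G k] are constrained only for positive [k], so [k] is taken large enough to exclude
     0. *)
  near=> k; have [mG G0] : measurable (G k) /\ (0 < nu (G k))%E.
    by apply: GP; near: k; exact: nbhs_infty_gt.
  rewrite averageE// -(@divfK _ 2 _ e)// [leRHS]mulrC.
  apply: normc_Caverage_le => //; near: k; exact: unif.
- move=> cvgG e e0.
  (* For each [k], a set is selected whose average of [h k] controls the norm of [h k] up to the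
     factor 8; the tolerance [e / 8] below absorbs that factor. *)
  have [G GP] := choice (fun k => exists_Caverage_ge (hoo k)).
  have GP' k : (0 < k)%N -> measurable (G k) /\ (0 < nu (G k))%E.
    by have [] := GP k.
  have e80 : 0 < e / 8 by rewrite divr_gt0.
  have /cvgc_distP/(_ _ e80) := cvgG G GP'.
  apply: filterS => k; have [mG G0 hG] := GP k.
  rewrite averageE// => le; apply: (le_trans hG).
  by rewrite lee_fin mulrC -ler_pdivlMr.
Unshelve. all: by end_near. Qed.
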